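(* Let $(\mathbb{F}(t),\sigma)$ be a $\Pi\Sigma$-extension of $(\mathbb{F},\sigma)$, let $A_0,\dots,A_\ell\in\mathbb{F}[t]^{n\times n}$, $b\in\mathbb{F}[t]^n$, and let $A=A_\ell\sigma^\ell+\dots+A_1\sigma+A_0\in\mathbb{F}(t)[\sigma]^{n\times n}$ be such that the system $A(y)=b$ is fully regular. Let $P\in\mathrm{GL}_n(\mathbb{F}(t)[\sigma,\sigma^{-1}])$ be such that $PA=\tilde A_{\tilde\ell}\sigma^{\tilde\ell}+\dots+\tilde A_1\sigma+\tilde A_0$ with $\tilde A_0,\dots,\tilde A_{\tilde\ell}\in\mathbb{F}[t]^{n\times n}$, $P(b)\in\mathbb{F}[t]^n$ and $\det\tilde A_0\ne0$. Let $m\in\mathbb{F}[t]\setminus\{0\}$ be the common denominator of the entries of $A_\ell^{-1}$ and $p\in\mathbb{F}[t]\setminus\{0\}$ the common denominator of the entries of $\tilde A_0^{-1}$. Let $y=d^{-1}z\in\mathbb{F}(t)^n$ be a solution of $A(y)=b$ in reduced representation. Then $$\mathrm{disp}(\operatorname{ap}(d))\le \mathrm{disp}\big(\sigma^{-\ell}(\operatorname{ap}(m)),\operatorname{ap}(p)\big)=:D$$ and $$\operatorname{ap}(d)\;\Big|\;\gcd\Big(\prod_{j=0}^{D}\sigma^{-\ell-j}(\operatorname{ap}(m)),\ \prod_{j=0}^{D}\sigma^{j}(\operatorname{ap}(p))\Big).$$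
   Context: All fields contain $\mathbb{Q}$. A difference field $(\mathbb{F},\sigma)$ is a field with an automorphism $\sigma$; $\mathrm{const}\,\mathbb{F}=\{c:\sigma(c)=c\}$. A $\Pi\Sigma$-extension $(\mathbb{F}(t),\sigma)$ of $(\mathbb{F},\sigma)$: $\mathbb{F}(t)$ is a rational function field, $\sigma$ extends to an automorphism of $\mathbb{F}(t)$ with either $\sigma(t)=t+\beta$, $\beta\in\mathbb{F}\setminus\{0\}$ ($\Sigma$-monomial) or $\sigma(t)=\alpha t$, $\alpha\in\mathbb{F}\setminus\{0\}$ ($\Pi$-monomial), and $\mathrm{const}\,\mathbb{F}(t)=\mathrm{const}\,\mathbb{F}$. For $a,b\in\mathbb{F}[t]\setminus\{0\}$: $\mathrm{spread}(a,b)=\{k\ge0:\gcd(a,\sigma^k(b))\notin\mathbb{F}\}$, $\mathrm{disp}(a,b)=\max\mathrm{spread}(a,b)$ ($\max\emptyset=-\infty$, max of an infinite set $=\infty$), $\mathrm{disp}(a)=\mathrm{disp}(a,a)$; empty products equal $1$. $\mathrm{per}(a)=1$ if $t$ is a $\Sigma$-monomial, $\mathrm{per}(a)=t^\mu$ with $\mu$ maximal such that $t^\mu\mid a$ if $t$ is a $\Pi$-monomial; $\operatorname{ap}(a)=a/\mathrm{per}(a)$. A reduced representation $y=d^{-1}z$ has $d\in\mathbb{F}[t]\setminus\{0\}$, $z\in\mathbb{F}[t]^n$, $\gcd(z_1,\dots,z_n,d)=1$. Ore polynomials: $\mathbb{F}(t)[\sigma]$ is the ring of polynomials $\sum a_i\sigma^i$,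 $a_i\in\mathbb{F}(t)$, with usual addition and multiplication determined by $\sigma\cdot a=\sigma(a)\cdot\sigma$; $\mathbb{F}(t)[\sigma,\sigma^{-1}]$ is its localisation at the powers of $\sigma$ (Ore Laurent polynomials). An operator $L=\sum a_i\sigma^i$ acts on $\alpha\in\mathbb{F}(t)$ by $L(\alpha)=\sum a_i\sigma^i(\alpha)$; a matrix $L=(L_{ij})$ of operators acts on a vector $\alpha=(\alpha_j)$ by $L(\alpha)=(\sum_j L_{ij}(\alpha_j))_i$. A square operator matrix is unimodular if it has a two-sided inverse over the same ring; $\mathrm{GL}_n(\cdot)$ denotes unimodular matrices. A system $A(y)=b$ with $A=\sum_{i=0}^\ell A_i\sigma^i$, $A_i$ square $n\times n$, is head regular if $\det A_\ell\ne0$, tail regular if $\det A_0\ne0$, and fully regular if it is head regular and there exists $P\in\mathrm{GL}_n(\mathbb{F}(t)[\sigma,\sigma^{-1}])$ such that $PA\in\mathbb{F}(t)[\sigma]^{n\times n}$ and the system $(PA)(\tilde y)=P(b)$ is tail regular. *)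

(* Defs.v *)
From HB Require Import structures.
From mathcomp Require Import all_boot all_order all_algebra.
From Stdlib Require Import Classical ClassicalEpsilon.
Set Implicit Arguments. Unset Strict Implicit. Unset Printing Implicit Defensive.
Import Order.TTheory GRing.Theory Num.Theory.
Local Open Scope ring_scope.

(* Kind of the monomial t of a PiSigma-extension F(t) of F:
   Sigma c : sigma(t) = t + c ;   Pi c : sigma(t) = c * t. *)
Inductive monokind (F : Type) := SigmaMon of F | PiMon of F.

Section DiffField.
Variables (F : fieldType) (sF : {rmorphism F -> F}) (sFi : F -> F).
Variable (mk : monokind F).

Definition sigP (p : {poly F}) : {poly F} :=
  match mk with
  | SigmaMon c => (map_poly sF p) \Po ('X + c%:P)
  | PiMon c => (map_poly sF p) \Po (c *: 'X)
  end.

Definition sigPinv (q : {poly F}) : {poly F} :=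
  match mk with
  | SigmaMon c => map_poly sFi (q \Po ('X - c%:P))
  | PiMon c => map_poly sFi (q \Po (c^-1 *: 'X))
  end.

Definition sigPz (k : int) (p : {poly F}) : {poly F} :=
  match k with
  | Posz n => iter n sigP p
  | Negz n => iter n.+1 sigPinv p
  end.

Definition K := {fraction {poly F}}.
Definition toK (p : {poly F}) : K := @FracField.tofrac _ p.

Definition sigK (x : K) : K :=
  let r := repr x in (toK (sigP \n_r)) / (toK (sigP \d_r)).
Definition sigKinv (x : K) : K :=
  let r := repr x in (toK (sigPinv \n_r)) / (toK (sigPinv \d_r)).
Definition sigKz (k : int) (x : K) : K :=
  match k with
  | Posz n => iter n sigK x
  | Negz n => iter n.+1 sigKinv x
  end.

Definition PiSigma_ext : Prop :=
  [/\ [pchar F] =i pred0,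
      cancel sF sFi, cancel sFi sF,
      (match mk with SigmaMon c => c != 0 | PiMon c => c != 0 end) &
      forall x : K, sigK x = x -> exists c : F, x = (toK (c%:P))].

Definition per (a : {poly F}) : {poly F} :=
  match mk with
  | SigmaMon _ => 1
  | PiMon _ => 'X ^+ (mup 0 a)
  end.
Definition ap (a : {poly F}) : {poly F} := a %/ per a.

Definition spread (a b : {poly F}) : pred nat :=
  fun k => (1 < size (gcdp a (sigPz k%:Z b)))%N.

Inductive extnat := MInf | Fin of nat | PInf.

Definition extnat_le (x y : extnat) : bool :=
  match x, y with
  | MInf, _ => true
  | _, PInf => true
  | Fin a, Fin b => (a <= b)%N
  | _, _ => false
  end.

Definition disp (a b : {poly F}) : extnat :=
  match excluded_middle_informative (exists k, spread a b k) with
  | left Hex =>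
    match excluded_middle_informative
            (exists N, forall k, spread a b k -> (k <= N)%N) with
    | left Hb =>
        let (N, HN) := constructive_indefinite_description _ Hb in
        Fin (ex_maxn Hex HN)
    | right _ => PInf
    end
  | right _ => MInf
  end.

(* \prod_{j=0}^{D} f j ; empty product (=1) for D = -oo.
   D = +oo never occurs in the theorem; we put 0 there. *)
Definition prod_upto (D : extnat) (f : nat -> {poly F}) : {poly F} :=
  match D with
  | MInf => 1
  | Fin N => \prod_(0 <= j < N.+1) f j
  | PInf => 0
  end.

(* OLMx lo [:: L_0; ...; L_r] represents  sum_i L_i sigma^(lo+i). *)
Variable n : nat.
Record olmx := OLMx { ol_lo : int; ol_cs : seq 'M[K]_n }.

Definition olc (L : olmx) (k : int) : 'M[K]_n :=
  if (ol_lo L <= k) then nth 0 (ol_cs L) `|k - ol_lo L|%N else 0.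

Definition ol_eq (L M : olmx) : Prop := forall k, olc L k = olc M k.

(* product, using sigma^a * M = sigma^a(M) * sigma^a *)
Definition olmul (L M : olmx) : olmx :=
  OLMx (ol_lo L + ol_lo M)
    [seq \sum_(i < size (ol_cs L)) \sum_(j < size (ol_cs M) | (i + j == m)%N)
           (ol_cs L)`_i *m map_mx (sigKz (ol_lo L + i%:Z)) (ol_cs M)`_j
     | m <- iota 0 (size (ol_cs L) + size (ol_cs M))].

Definition olid : olmx := OLMx 0 [:: 1%:M].

Definition olapply (L : olmx) (y : 'cV[K]_n) : 'cV[K]_n :=
  \sum_(i < size (ol_cs L)) (ol_cs L)`_i *m map_mx (sigKz (ol_lo L + i%:Z)) y.

Definition ol_unimodular (P : olmx) : Prop :=
  exists Q, ol_eq (olmul Q P) olid /\ ol_eq (olmul P Q) olid.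

Definition ol_of_polys (l : nat) (A : nat -> 'M[{poly F}]_n) : olmx :=
  OLMx 0 [seq map_mx toK (A i) | i <- iota 0 l.+1].

Definition head_regular (l : nat) (A : nat -> 'M[{poly F}]_n) : Prop :=
  \det (map_mx toK (A l)) != 0 :> K.
Definition fully_regular (l : nat) (A : nat -> 'M[{poly F}]_n) : Prop :=
  head_regular l A /\
  exists P, [/\ ol_unimodular P,
     (forall k : int, k < 0 -> olc (olmul P (ol_of_polys l A)) k = 0) &
     \det (olc (olmul P (ol_of_polys l A)) 0) != 0].

Definition clears_denoms (M : 'M[K]_n) (q : {poly F}) : Prop :=
  exists N : 'M[{poly F}]_n, (toK q) *: M = map_mx toK N.
Definition common_denom (M : 'M[K]_n) (q : {poly F}) : Prop :=
  [/\ q != 0, clears_denoms M q &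
      forall q', q' != 0 -> clears_denoms M q' -> q %| q'].

Definition reduced_rep (d : {poly F}) (z : 'cV[{poly F}]_n) : Prop :=
  d != 0 /\ coprimep d (\big[@gcdp F/0]_(i < n) z i 0).
Definition rep_vec (d : {poly F}) (z : 'cV[{poly F}]_n) : 'cV[K]_n :=
  (toK d)^-1 *: map_mx toK z.

End DiffField.

(* Main.v *)
Require Import Defs.
From HB Require Import structures.
From mathcomp Require Import all_boot all_order all_algebra.
From mathcomp Require Import zify.
From Stdlib Require Import Classical ClassicalEpsilon.
Import Order.TTheory GRing.Theory Num.Theory.
Local Open Scope ring_scope.

(* Multiplying A(y) = b by A_l^-1, and (PA)(y) = P(b) by the inverse of the tail
   coefficient, bounds the denominator of an extreme shift of y by those of the
   other shifts: d divides sigma^-l(m) * lcm_{i=1..l} sigma^-i(d) and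
   p * lcm_{i=1..lt} sigma^i(d).  Substituting these divisibilities into
   themselves N times gives d | prod_{j<N} sigma^j(p) * lcm_{i>=N} sigma^i(d),
   and likewise on the other side.  If N exceeds disp(ap(d)), the lcm is coprime
   to ap(d).  If M = disp(ap(d)), then gcd(ap(d), sigma^M(ap(d))) is coprime to
   both lcms (after shifting the second by M), hence divides both
   sigma^-l(ap(m)) and sigma^M(ap(p)), so that M <= D.
   Dispersions are finite because sigma^k(q) ~ q, k > 0, forces q to be constant
   once the factor t is excluded for a Pi-monomial. *)

Section PiSigmaExtension.
Context {F : fieldType} {sF : {rmorphism F -> F}} {sFi : F -> F} {mk : monokind F}.
Hypothesis ext : PiSigma_ext sF sFi mk.

Local Notation sg := (sigPz sF sFi mk).
Local Notation s1 := (sigP sF mk).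

(** * The automorphism on F[t] and its integer powers *)

Definition sigX : {poly F} :=
  match mk with SigmaMon c => 'X + c%:P | PiMon c => c *: 'X end.

Lemma sigPE (p : {poly F}) : s1 p = map_poly sF p \Po sigX.
Proof. by rewrite /sigP /sigX; case: mk. Qed.

Lemma sigP_zmod_morphism : zmod_morphism s1.
Proof. by move=> p q; rewrite !sigPE rmorphB comp_polyB. Qed.

Lemma sigP_monoid_morphism : monoid_morphism s1.
Proof.
by split=> [|p q]; rewrite !sigPE ?rmorph1 ?comp_polyC // rmorphM comp_polyM.
Qed.

HB.instance Definition _ :=
  GRing.isZmodMorphism.Build {poly F} {poly F} s1 sigP_zmod_morphism.
HB.instance Definition _ :=
  GRing.isMonoidMorphism.Build {poly F} {poly F} s1 sigP_monoid_morphism.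

Lemma sigPK : cancel s1 (sigPinv sFi mk).
Proof.
move=> p; have [_ sFK _ mk0 _] := ext; rewrite /sigP /sigPinv.
have s0 : sFi 0 = 0 by have := sFK 0; rewrite rmorph0.
case: (mk) mk0 => c c0; rewrite -comp_polyA.
  by rewrite comp_polyD comp_polyX comp_polyC addrNK comp_polyXr map_polyK.
by rewrite comp_polyZ comp_polyX scalerA divff // scale1r comp_polyXr map_polyK.
Qed.

Lemma sigPinvK : cancel (sigPinv sFi mk) s1.
Proof.
move=> p; have [_ _ sFK mk0 _] := ext; rewrite /sigP /sigPinv.
case: (mk) mk0 => c c0; rewrite map_polyK ?rmorph0 // -comp_polyA.
  by rewrite comp_polyB comp_polyX comp_polyC addrK comp_polyXr.
by rewrite comp_polyZ comp_polyX scalerA mulVf // scale1r comp_polyXr.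
Qed.

Lemma sigPzS (k : int) (p : {poly F}) : sg (1 + k) p = s1 (sg k p).
Proof.
case: k => [n|n]; first by rewrite -intS.
have -> : 1 + Negz n = - n%:Z by rewrite NegzE intS; lia.
by case: n => [|n] /=; rewrite -?NegzE /= sigPinvK.
Qed.

Lemma sigPzB1 (k : int) (p : {poly F}) : sg (k - 1) p = sigPinv sFi mk (sg k p).
Proof. by rewrite -[in RHS](subrK 1 k) [k - 1 + 1]addrC sigPzS sigPK. Qed.

Lemma sigPzD (i j : int) (p : {poly F}) : sg (i + j) p = sg i (sg j p).
Proof.
elim: i => [|n IH|n IH]; first by rewrite add0r.
  by rewrite intS -addrA !sigPzS IH.
rewrite (_ : - (n.+1)%:Z = - n%:Z - 1); last by lia.
by rewrite addrAC !sigPzB1 IH.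
Qed.

Lemma sigPzK (k : int) : cancel (sg k) (sg (- k)).
Proof. by move=> p; rewrite -sigPzD addNr. Qed.

Lemma sigPzNK (k : int) : cancel (sg (- k)) (sg k).
Proof. by move=> p; rewrite -sigPzD addrN. Qed.

Lemma sigPz_inj (k : int) : injective (sg k).
Proof. exact: can_inj (sigPzK k). Qed.

Lemma sigPz_zmod_morphism (k : int) : zmod_morphism (sg k).
Proof.
have pos n : zmod_morphism (sg n%:Z).
  by elim: n => [//|n IH] p q; rewrite intS !sigPzS IH rmorphB.
case: k => n; first exact: pos.
rewrite NegzE => p q; apply: (@sigPz_inj n.+1).
by rewrite pos !sigPzNK.
Qed.

Lemma sigPz_monoid_morphism (k : int) : monoid_morphism (sg k).
Proof.
have pos n : monoid_morphism (sg n%:Z).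
  elim: n => [//|n [IH1 IHM]]; split=> [|p q]; rewrite intS !sigPzS ?IH1 ?rmorph1 //.
  by rewrite IHM rmorphM.
case: k => n; first exact: pos.
rewrite NegzE; have [p1 pM] := pos n.+1; split=> [|p q].
  by rewrite -[in LHS]p1 sigPzK.
apply: (@sigPz_inj n.+1); rewrite sigPzNK.
by rewrite [RHS](pM (sg (- n.+1%:Z) p) (sg (- n.+1%:Z) q)) !sigPzNK.
Qed.

HB.instance Definition _ (k : int) :=
  GRing.isZmodMorphism.Build {poly F} {poly F} (sg k) (sigPz_zmod_morphism k).
HB.instance Definition _ (k : int) :=
  GRing.isMonoidMorphism.Build {poly F} {poly F} (sg k) (sigPz_monoid_morphism k).

Lemma sigPz_eq0 (k : int) (p : {poly F}) : (sg k p == 0) = (p == 0).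
Proof. by rewrite -[RHS](inj_eq (@sigPz_inj k)) rmorph0. Qed.

Lemma dvdp_sigPz (k : int) (p q : {poly F}) : (sg k p %| sg k q) = (p %| q).
Proof.
have imp j a b : a %| b -> sg j a %| sg j b.
  by case/dvdpP=> c ->; rewrite rmorphM dvdp_mull.
by apply/idP/idP => [/(imp (- k))|/imp //]; rewrite !sigPzK.
Qed.

Lemma eqp_sigPz (k : int) (p q : {poly F}) : (sg k p %= sg k q) = (p %= q).
Proof. by rewrite /eqp !dvdp_sigPz. Qed.

(** Sigma moves the coefficients too, so coprimality is transported through a Bezout identity, which
    any ring morphism preserves. *)
Lemma coprimep_sigPz (k : int) (p q : {poly F}) :
  coprimep (sg k p) (sg k q) = coprimep p q.
Proof.
have imp j a b : coprimep a b -> coprimep (sg j a) (sg j b).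
  case/Bezout_eq1_coprimepP=> u uE; apply/Bezout_eq1_coprimepP.
  by exists (sg j u.1, sg j u.2); rewrite /= -!rmorphM -rmorphD uE rmorph1.
by apply/idP/idP => [/(imp (- k))|/imp //]; rewrite !sigPzK.
Qed.

Lemma coprimep_sigPzN (k : int) (p q : {poly F}) :
  coprimep (sg (- k) p) q = coprimep p (sg k q).
Proof. by rewrite -(coprimep_sigPz k) sigPzNK. Qed.

(** * Separating the factor t of a Pi-monomial *)

Definition tfree (q : {poly F}) : bool :=
  if mk is PiMon _ then coprimep q 'X else true.

Lemma tfree_dvd (p q : {poly F}) : q %| p -> tfree p -> tfree q.
Proof. by rewrite /tfree; case: (mk) => // _; apply: coprimep_dvdr. Qed.

(** For a Pi-monomial, sigma(t) = c * t is an associate of t. *)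
Lemma tfree_sigPz (k : int) (q : {poly F}) : tfree (sg k q) = tfree q.
Proof.
have sX a : tfree (s1 a) = tfree a.
  rewrite -[s1 a]/(sg 1 a) /tfree; have [_ _ _ + _] := ext; case E: mk => [//|c] c0.
  rewrite -[RHS](coprimep_sigPz 1) E.
  by rewrite [sigPz _ _ _ 1 'X]/= /sigP map_polyX comp_polyX coprimepZr.
elim: k => [//|n IH|n IH]; first by rewrite intS sigPzS sX.
by rewrite -IH (_ : - n%:Z = 1 + (- (n.+1)%:Z)) ?[in RHS]sigPzS ?sX //; lia.
Qed.

(* Over a Pi-monomial these are the constant multiples of powers of t. *)
Definition tpart (w : {poly F}) : Prop := forall q, tfree q -> coprimep q w.

Lemma tpart_sigPz (k : int) (w : {poly F}) : tpart w -> tpart (sg k w).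
Proof. by move=> tw q tq; rewrite -coprimep_sigPzN tw // tfree_sigPz. Qed.

Lemma ap_per (a : {poly F}) : a != 0 ->
  [/\ a = ap mk a * per mk a, tfree (ap mk a) & tpart (per mk a)].
Proof.
move=> a0; rewrite /ap /per /tpart /tfree; case: (mk) => c.
  by rewrite divp1 mulr1; split=> // q _; rewrite coprimep1.
have X0 : 'X = 'X - 0%:P :> {poly F} by rewrite subr0.
have dv : 'X ^+ mup 0 a %| a by rewrite X0 -mup_geq.
split; [by rewrite divpK | | by move=> q; apply: coprimep_expr].
(* A root of [ap mk a] at 0 would give one more factor t of [a], against the maximality of
   [mup 0 a]. *)
rewrite [X in coprimep _ X]X0 coprimep_XsubC.
apply/negP; rewrite root_factor_theorem -X0 => /dvdpP[r rE].
have : 'X ^+ (mup 0 a).+1 %| a.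
  by rewrite -[X in _ %| X](divpK dv) rE -mulrA -exprS dvdp_mull.
by rewrite X0 -mup_geq // ltnn.
Qed.

Lemma ap_neq0 (a : {poly F}) : a != 0 -> ap mk a != 0.
Proof.
by move=> a0; have [e _ _] := ap_per _ a0; apply: contraNneq a0 => a1; rewrite e a1 mul0r.
Qed.


(** * Fractions and semi-invariant polynomials *)

Lemma toK_eq0 (p : {poly F}) : (toK p == 0) = (p == 0).
Proof. exact: tofrac_eq0. Qed.

Lemma toK_inj : injective (@toK F).
Proof. by move=> p q /eqP; rewrite /toK tofrac_eq => /eqP. Qed.

Lemma toK_frac (x : K F) (r := repr x : {ratio {poly F}}) :
  x = toK \n_r / toK \d_r.
Proof.
have d0 : toK \d_r != 0 by rewrite toK_eq0 denom_ratioP.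
apply: (canRL (mulfK d0)); rewrite -[x in LHS](@reprK _ _ x) -/r /toK.
apply/eqP; rewrite !piE FracField.equivfE /FracField.mulf.
by rewrite !numden_Ratio ?mulr1 ?oner_neq0 ?denom_ratioP // mulrC.
Qed.

(** [sigK] and [sigKinv] use a chosen representative. The choice does not matter: equal fractions
    satisfy a cross-multiplied identity in F[t], which the injective ring morphism [sg k]
    preserves. *)
Lemma sigPz_frac (k : int) (p q : {poly F})
    (r := repr (toK p / toK q : K F) : {ratio {poly F}}) : q != 0 ->
  toK (sg k \n_r) / toK (sg k \d_r) = toK (sg k p) / toK (sg k q).
Proof.
move=> q0; have d0 : \d_r != 0 by exact: denom_ratioP.
apply/eqP; rewrite eqr_div ?toK_eq0 ?sigPz_eq0 // /toK -!tofracM -!rmorphM.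
rewrite tofrac_eq (inj_eq (@sigPz_inj k)) -tofrac_eq !tofracM -eqr_div ?tofrac_eq0 //.
exact/eqP/esym/(toK_frac (toK p / toK q)).
Qed.

Lemma sigK_frac (p q : {poly F}) : q != 0 ->
  sigK sF mk (toK p / toK q) = toK (s1 p) / toK (s1 q).
Proof. exact: (@sigPz_frac 1). Qed.

Lemma sigKinv_frac (p q : {poly F}) : q != 0 ->
  sigKinv sFi mk (toK p / toK q) = toK (sg (-1) p) / toK (sg (-1) q).
Proof. exact: (@sigPz_frac (-1)). Qed.

Lemma sigP_eigen_const (h : {poly F}) : s1 h = h -> (size h <= 1)%N.
Proof.
move=> hE; have [_ _ _ _ cst] := ext.
have [|c /toK_inj ->] := cst (toK h); last by rewrite size_polyC; case: eqP.
by have := sigK_frac h 1 (oner_neq0 _); rewrite rmorph1 hE /toK tofrac1 divr1.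
Qed.

(** With a common eigenvalue the quotient p / q is fixed by sigma, so it is a constant of the
    extension. *)
Lemma sigP_ratio_const (p q : {poly F}) (u : F) : p != 0 -> q != 0 -> u != 0 ->
  s1 p = u *: p -> s1 q = u *: q -> exists c : F, p = c *: q.
Proof.
move=> p0 q0 u0 pE qE; have [_ _ _ _ cst] := ext.
have [|c cE] := cst (toK p / toK q).
  rewrite sigK_frac // pE qE -!mul_polyC /toK !tofracM -mulf_div divff ?mul1r //.
  by rewrite tofrac_eq0 polyC_eq0.
exists c; apply: toK_inj; rewrite -mul_polyC /toK tofracM -[X in X * _]cE.
by rewrite divfK // tofrac_eq0.
Qed.

Lemma sigP_monomial (c a : F) (i : nat) : mk = PiMon c ->
  s1 (a *: 'X^i) = (sF a * c ^+ i) *: 'X^i.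
Proof.
move=> E; rewrite /sigP E map_polyZ map_polyXn comp_polyZ comp_Xn_poly.
by rewrite exprZn scalerA.
Qed.

Lemma coef_sigP_Pi (c : F) (p : {poly F}) (i : nat) : mk = PiMon c ->
  (s1 p)`_i = sF p`_i * c ^+ i.
Proof.
move=> E; rewrite /sigP E comp_polyE size_map_poly.
under eq_bigr => j _ do rewrite exprZn scalerA coef_map.
rewrite -(poly_def (size p) (fun j => sF p`_j * c ^+ j)) coef_poly.
by case: ltnP => // h; rewrite nth_default // rmorph0 mul0r.
Qed.

(* If t is a Sigma-monomial, g made monic is fixed by sigma; if t is a
   Pi-monomial, the quotient of two monomials of g is fixed by sigma. *)
Lemma sigP_eigen (g : {poly F}) (u : F) : g != 0 -> s1 g = u *: g ->
  tfree g -> (size g <= 1)%N.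
Proof.
move=> g0 gE; have lg : lead_coef g != 0 by rewrite lead_coef_eq0.
have s1g0 : s1 g != 0 by rewrite -[s1 g]/(sg 1 g) sigPz_eq0.
have u0 : u != 0 by apply: contraNneq s1g0 => u0; rewrite gE u0 scale0r.
rewrite /tfree; case E: mk => [c|c].
  move=> _; set a := lead_coef g; pose h := a^-1 *: g.
  have ag : a *: h = g by rewrite scalerA divff // scale1r.
  have h1 : lead_coef h = 1 by rewrite lead_coefZ mulVf.
  rewrite -ag size_scale //; apply: sigP_eigen_const.
  have hE : s1 h = (u * a / sF a) *: h.
    apply: (@scalerI _ _ (sF a)); rewrite ?fmorph_eq0 //.
    have <- : s1 (a *: h) = sF a *: s1 h.
      by rewrite -!mul_polyC rmorphM /= sigPE map_polyC comp_polyC.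
    rewrite ag gE -{1}ag !scalerA; congr (_ *: _).
    by rewrite mulrCA divff ?mulr1 // fmorph_eq0.
  (* The substitution t -> t + c keeps monic polynomials monic, so the eigenvalue of [h] must be
     1. *)
  have : lead_coef (s1 h) = 1.
    rewrite sigPE lead_coef_comp ?lead_coef_map ?h1 ?rmorph1 ?mul1r.
      by rewrite /sigX E lead_coefXaddC expr1n.
    by rewrite /sigX E size_XaddC.
  by rewrite hE lead_coefZ h1 mulr1 => ->; rewrite scale1r.
rewrite -['X]subr0 coprimep_XsubC rootE horner_coef0 => g00.
rewrite leqNgt; apply/negP => sg1.
(* Comparing coefficients makes every nonzero monomial of [g] an eigenvector for the same [u]. *)
have cE i : sF g`_i * c ^+ i = u * g`_i by rewrite -coef_sigP_Pi // gE coefZ.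
have mE i : s1 (g`_i *: 'X^i) = u *: (g`_i *: 'X^i).
  by rewrite (sigP_monomial c) // cE scalerA.
have m0 i : g`_i != 0 -> g`_i *: 'X^i != 0 :> {poly F}.
  by move=> gi; rewrite scaler_eq0 negb_or gi monic_neq0 ?monicXn.
have gl : g`_(size g).-1 != 0 by [].
(* The two monomials are the leading one and the constant one, which is nonzero as [g] is prime to
   t. Proportionality contradicts their different degrees. *)
have [k kE] := sigP_ratio_const _ _ _ (m0 _ gl) (m0 _ g00) u0 (mE _) (mE _).
have := congr1 (fun p : {poly F} => p`_(size g).-1) kE.
have -> : (size g).-1 = (size g).-2.+1 by lia.
rewrite !coefZ !coefXn eqxx mulr1 /= !mulr0 => /eqP.
by rewrite (_ : (size g).-2.+1 = (size g).-1) ?(negPf gl) //; lia.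
Qed.

Lemma tfreeM (p q : {poly F}) : tfree (p * q) = tfree p && tfree q.
Proof. by rewrite /tfree; case: (mk) => // _; rewrite coprimepMl. Qed.

(* The product g of sigma^i(q), i < k, satisfies sigma(g) = g * sigma^k(q) / q. *)
Lemma sigPz_eigen (k : nat) (q : {poly F}) : (0 < k)%N -> q != 0 -> tfree q ->
  sg k q %= q -> (size q <= 1)%N.
Proof.
move=> k0 q0 tq /eqpP[[a c] /= /andP[a0 c0] acE].
pose g := \prod_(0 <= i < k) sg i%:Z q.
have qg : q %| g by rewrite /g big_ltn // dvdp_mulr.
have g0 : g != 0 by rewrite prodf_seq_neq0; apply/allP=> i _; rewrite sigPz_eq0.
(* Both sides are the product of sigma^i(q) for 0 <= i <= k. *)
have gE : s1 g * q = g * sg k q.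
  rewrite /g rmorph_prod /= -(big_nat_recr k 0 (fun i => sg i%:Z q)) //=.
  rewrite big_nat_recl // mulrC; congr (_ * _).
have tg : tfree g.
  rewrite /g; elim/big_ind: _ => [|p r tp tr|i _]; rewrite ?tfree_sigPz //.
    by rewrite /tfree; case: (mk) => // _; rewrite coprime1p.
  by rewrite tfreeM tp.
have : s1 g = (c / a) *: g.
  apply: (mulIf q0); rewrite gE.
  have -> : sg k q = (c / a) *: q.
    by apply: (scalerI a0); rewrite acE scalerA mulrCA divff // mulr1.
  by rewrite -scalerAr scalerAl.
move/(sigP_eigen _ _ g0) => /(_ tg); apply: leq_trans.
exact: dvdp_leq.
Qed.

(** * Finiteness of the dispersion *)

Lemma spreadE (a b : {poly F}) (k : nat) : a != 0 ->
  spread sF sFi mk a b k = ~~ coprimep a (sg k b).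
Proof.
move=> a0; rewrite /spread coprimep_def.
have : (0 < size (gcdp a (sg k b)))%N by rewrite size_poly_gt0 gcdp_eq0 (negPf a0).
by move: (size _) => s; case: s => [|[|s]].
Qed.

Lemma reducible_factor (a : {poly F}) : (1 < size a)%N -> ~ irreducible_poly a ->
  exists a1 a2, [/\ a = a1 * a2, (size a1 < size a)%N & (size a2 < size a)%N].
Proof.
move=> sa nirr; have a0 : a != 0 by rewrite -size_poly_gt0 ltnW.
have [q [q1 qa nqa]] : exists q : {poly F}, [/\ size q != 1, q %| a & ~~ (q %= a)].
  apply: NNPP => nex; apply: nirr; split=> // q q1 qa.
  by apply/negPn/negP => nqa; apply: nex; exists q.
have q0 : q != 0 by apply: contraNneq a0 => q0; rewrite -dvd0p -q0.
have /dvdpP[r rE] := qa; have r0 : r != 0.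
  by apply: contraNneq a0 => r0; rewrite rE r0 mul0r.
have sq : (size q < size a)%N.
  by rewrite ltn_neqAle dvdp_leq // andbT dvdp_size_eqp.
have sq1 : (1 < size q)%N by rewrite ltn_neqAle eq_sym q1 size_poly_gt0.
exists r, q; split=> //; rewrite rE size_mul //.
by move: (size q) sq1 => [|[|k]] // _; rewrite !addnS /= ltnS leq_addr.
Qed.

(** Induction on the total size: a factorization of [a] or [b] splits the spread. For irreducible
    [a] and [b], a member k makes [a] an associate of sigma^k(b); two distinct members would make
    [b] an associate of a proper shift of itself. *)
Lemma spread_bounded (a b : {poly F}) : a != 0 -> b != 0 -> tfree b ->
  exists N, forall k : nat, ~~ coprimep a (sg k b) -> (k <= N)%N.
Proof.
have [n] := ubnP (size a + size b)%N; elim: n a b => [//|n IH] a b.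
rewrite ltnS => sab a0 b0 tb.
have [sa|sa] := leqP (size a) 1.
  exists 0%N => k; have a1 : a %= 1 by rewrite -size_poly_eq1 eqn_leq sa size_poly_gt0.
  by rewrite (eqp_coprimepl _ a1) coprime1p.
have [sb|sb] := leqP (size b) 1.
  exists 0%N => k; have b1 : b %= 1 by rewrite -size_poly_eq1 eqn_leq sb size_poly_gt0.
  have : sg k b %= 1 by rewrite -(rmorph1 (sg k)) eqp_sigPz.
  by move=> b1'; rewrite (eqp_coprimepr _ b1') coprimep1.
have [ia|nia] := classic (irreducible_poly a); last first.
  have [a1 [a2 [aE s1a s2a]]] := reducible_factor _ sa nia.
  have [a10 a20] : a1 != 0 /\ a2 != 0 by apply/andP; rewrite -negb_or -mulf_eq0 -aE.
  have [|N1 h1] := IH a1 b _ a10 b0 tb; first by lia.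
  have [|N2 h2] := IH a2 b _ a20 b0 tb; first by lia.
  exists (maxn N1 N2) => k; rewrite aE coprimepMl negb_and leq_max.
  by case/orP=> [/h1->|/h2->]; rewrite ?orbT.
have [ib|nib] := classic (irreducible_poly b); last first.
  have [b1 [b2 [bE s1b s2b]]] := reducible_factor _ sb nib.
  have [b10 b20] : b1 != 0 /\ b2 != 0 by apply/andP; rewrite -negb_or -mulf_eq0 -bE.
  have /andP[tb1 tb2] : tfree b1 && tfree b2 by rewrite -tfreeM -bE.
  have [|N1 h1] := IH a b1 _ a0 b10 tb1; first by lia.
  have [|N2 h2] := IH a b2 _ a0 b20 tb2; first by lia.
  exists (maxn N1 N2) => k; rewrite bE rmorphM coprimepMr negb_and leq_max.
  by case/orP=> [/h1->|/h2->]; rewrite ?orbT.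
have assoc k : ~~ coprimep a (sg k b) -> a %= sg k b.
  move=> nc; rewrite /eqp; move: (nc); rewrite irreducible_poly_coprime // negbK => ->.
  rewrite -(sigPzNK k a) dvdp_sigPz -[_ %| _]negbK -(irreducible_poly_coprime _ ib).
  by rewrite coprimep_sym coprimep_sigPzN.
have [[N hN]|none] := classic (exists k : nat, ~~ coprimep a (sg k b)); last first.
  by exists 0%N => k hk; case: none; exists k.
exists N => k hk; rewrite leqNgt; apply/negP => Nk.
have : sg (k - N)%N b %= b.
  rewrite -(eqp_sigPz N) -sigPzD (_ : _ + _ = k%:Z); last by lia.
  by rewrite -(eqp_ltrans (assoc _ hk)) assoc.
move/sigPz_eigen; rewrite subn_gt0 => /(_ Nk b0 tb); lia.
Qed.

(** Opens the classical choices in [disp] once and for all; the bound on the spread excludes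
    [PInf]. *)
Lemma disp_fin (a b : {poly F}) : a != 0 -> b != 0 -> tfree b ->
  (disp sF sFi mk a b = MInf /\ forall k : nat, coprimep a (sg k b)) \/
  exists N, [/\ disp sF sFi mk a b = Fin N, ~~ coprimep a (sg N b) &
                forall k : nat, ~~ coprimep a (sg k b) -> (k <= N)%N].
Proof.
move=> a0 b0 tb; have [N bd] := spread_bounded a b a0 b0 tb.
rewrite /disp; case: excluded_middle_informative => [Hex|none]; last first.
  left; split=> // k; apply/negPn/negP; rewrite -spreadE // => h.
  by apply: none; exists k.
right; case: excluded_middle_informative => [Hb|]; last first.
  by case; exists N => k; rewrite spreadE //; apply: bd.
case: constructive_indefinite_description => B HB.
case: ex_maxnP => M; rewrite spreadE // => M1 M2; exists M; split=> // k.
by rewrite -spreadE //; apply: M2.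
Qed.

(** * From divisibility by shifts to the denominator bound *)

Local Arguments sigPz : simpl never.
(* E ranges over the common multiples of the sigma^(s i)(d): this says that d
   divides a times their least common multiple. *)
Definition shift_divides (s : int) (L : nat) (a d : {poly F}) : Prop :=
  forall E, (forall i : nat, (0 < i <= L)%N -> sg (s * i%:Z) d %| E) -> d %| a * E.

(** Induction on N: the last factor sigma^(s N)(a) is absorbed into [E]. The hypothesis, shifted by
    s N, shows that the new [E] is also a multiple of the shift of [d] with index N, at the price of
    the indices N + 1 to N + L. *)
Lemma shift_divides_iter (s : int) (L N : nat) (a d E : {poly F}) :
  shift_divides s L a d ->
  (forall i : nat, (N <= i <= N + L)%N -> sg (s * i%:Z) d %| E) ->
  d %| (\prod_(0 <= j < N) sg (s * j%:Z) a) * E.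
Proof.
move=> ad; elim: N E => [|N IH] E hE.
  by rewrite big_geq // mul1r; have := hE 0%N isT; rewrite mulr0.
rewrite big_nat_recr //= -mulrA; apply: IH => i /andP[Ni iNL].
have [iN|iN] := eqVneq i N; last first.
  by apply: dvdp_mull; apply: hE; lia.
rewrite iN -(sigPzNK (s * N%:Z) E) -rmorphM dvdp_sigPz; apply: ad => j jL.
rewrite -(dvdp_sigPz (s * N%:Z)) sigPzNK -sigPzD -mulrDr; apply: hE; lia.
Qed.

(** The shift of [per mk d] is a [tpart], hence coprime to [e]. *)
Lemma coprimep_sigPz_ap (e d : {poly F}) (k : int) : d != 0 -> tfree e ->
  coprimep e (sg k (ap mk d)) -> coprimep e (sg k d).
Proof.
move=> d0 te ced; have [dE _ tw] := ap_per _ d0.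
by rewrite dE rmorphM coprimepMr ced; apply: tpart_sigPz.
Qed.

(** In the iterated divisibility the far shifts of [d] and the shifts of [w] are coprime to
    [ap mk d], so Gauss's lemma removes both. *)
Lemma shift_divides_prod (s : int) (L N : nat) (a' w d : {poly F}) :
  d != 0 -> tpart w -> shift_divides s L (a' * w) d ->
  (forall i : nat, (N <= i)%N -> coprimep (ap mk d) (sg (s * i%:Z) (ap mk d))) ->
  ap mk d %| \prod_(0 <= j < N) sg (s * j%:Z) a'.
Proof.
move=> d0 tw aw cop; have [dE te _] := ap_per _ d0.
(* A product replaces the least common multiple, so that coprimality is checked factor by factor. *)
pose E := \prod_(N <= i < (N + L).+1) sg (s * i%:Z) d.
have : ap mk d %| (\prod_(0 <= j < N) sg (s * j%:Z) (a' * w)) * E.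
  apply: (@dvdp_trans _ d); first by rewrite [X in _ %| X]dE dvdp_mulr.
  apply: shift_divides_iter aw _ => i iN.
  by rewrite /E (big_rem i) ?dvdp_mulr //= mem_index_iota ltnS.
rewrite Gauss_dvdpl; last first.
  rewrite /E big_seq; elim/big_rec: _ => [|i x]; rewrite ?coprimep1 //.
  rewrite mem_index_iota => /andP[Ni _] cx.
  by rewrite coprimepMr cx andbT coprimep_sigPz_ap // cop.
under eq_bigr => j _ do rewrite rmorphM.
rewrite big_split /= Gauss_dvdpl //.
elim/big_rec: _ => [|i x _ cx]; rewrite ?coprimep1 // coprimepMr cx andbT.
exact: tpart_sigPz.
Qed.

(** The argument inside F[t]: the system enters only through the two [shift_divides] hypotheses. *)
Lemma disp_bound (l lt : nat) (m p d : {poly F}) :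
  m != 0 -> p != 0 -> d != 0 ->
  shift_divides (-1) l (sg (- l%:Z) m) d -> shift_divides 1 lt p d ->
  let D := disp sF sFi mk (sg (- (l%:Z)) (ap mk m)) (ap mk p) in
  extnat_le (disp sF sFi mk (ap mk d) (ap mk d)) D /\
  ap mk d %| gcdp
    (prod_upto D (fun j => sg (- (l%:Z + j%:Z)) (ap mk m)))
    (prod_upto D (fun j => sg j%:Z (ap mk p))).
Proof.
move=> m0 p0 d0 dm dp D.
have [dE te _] := ap_per _ d0; have [mE tm tmw] := ap_per _ m0.
have [pE tp tpw] := ap_per _ p0.
set e := ap mk d in dE te *; set m' := ap mk m in mE tm D *.
set p' := ap mk p in pE tp D *.
have e0 : e != 0 by exact: ap_neq0.
have m'0 : sg (- l%:Z) m' != 0 by rewrite sigPz_eq0 ap_neq0.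
have p'0 : p' != 0 by exact: ap_neq0.
rewrite mE rmorphM in dm; rewrite pE in dp.
have tmw' := tpart_sigPz (- l%:Z) _ tmw.
have ed : e %| d by rewrite dE dvdp_mulr.
(* Here M is the dispersion of [e]; the nonconstant gcd(e, sigma^M(e)) witnesses that M lies in the
   spread defining D. *)
have key (M : nat) : ~~ coprimep e (sg M e) ->
    (forall k : nat, ~~ coprimep e (sg k e) -> (k <= M)%N) ->
    ~~ coprimep (sg (- l%:Z) m') (sg M p').
  move=> nM maxM; pose g := gcdp e (sg M e).
  have ge : g %| e by apply: dvdp_gcdl.
  have gMe : g %| sg M e by apply: dvdp_gcdr.
  have tg := tfree_dvd _ _ ge te.
  have copM (k : nat) : (M < k)%N -> coprimep e (sg k e).
    by move=> Mk; apply/negPn/negP => /maxM; rewrite leqNgt Mk.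
  (* Shifting [dp] by M turns the factors of [E] into sigma^(M+i)(d) with i >= 1, beyond the
     dispersion and hence coprime to [g]. *)
  have gp : g %| sg M p'.
    pose E := \prod_(1 <= i < lt.+1) sg (1 * i%:Z) d.
    have : d %| p' * per mk p * E.
      apply: dp => i iL; by rewrite /E (big_rem i) ?dvdp_mulr //= mem_index_iota ltnS.
    rewrite -(dvdp_sigPz M) => /(dvdp_trans _) dvM.
    have : g %| sg M (p' * per mk p * E).
      by apply: dvM; apply: dvdp_trans gMe _; rewrite dvdp_sigPz.
    rewrite !rmorphM !Gauss_dvdpl //; first exact: tpart_sigPz.
    rewrite /E rmorph_prod big_seq; elim/big_rec: _ => [|i x]; rewrite ?coprimep1 //.
    rewrite mem_index_iota => /andP[i1 _] cx; rewrite coprimepMr cx andbT.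
    rewrite /= -sigPzD; apply: coprimep_sigPz_ap => //; apply: coprimep_dvdr ge _.
    by rewrite mul1r -PoszD; apply: copM; rewrite -[X in (X < _)%N]addn0 ltn_add2l.
  (* Now g is used as a divisor of sigma^M(e): this and sigma^(-i)(e) become, after a shift by i, a
     pair at distance M + i > M. *)
  have gm : g %| sg (- l%:Z) m'.
    pose E := \prod_(1 <= i < l.+1) sg (-1 * i%:Z) d.
    have : d %| sg (- l%:Z) m' * sg (- l%:Z) (per mk m) * E.
      apply: dm => i iL; by rewrite /E (big_rem i) ?dvdp_mulr //= mem_index_iota ltnS.
    move=> /(dvdp_trans (dvdp_trans ge ed)); rewrite !Gauss_dvdpl //; first exact: tmw'.
    rewrite /E big_seq; elim/big_rec: _ => [|i x]; rewrite ?coprimep1 //.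
    rewrite mem_index_iota => /andP[i1 _] cx; rewrite coprimepMr cx andbT.
    apply: coprimep_sigPz_ap => //; apply: coprimep_dvdr gMe _.
    rewrite -(coprimep_sigPz i) -!sigPzD coprimep_sym.
    rewrite mulN1r addrN.
    by apply: copM; rewrite -[X in (X < _)%N]add0n ltn_add2r.
  apply: contra nM => /coprimepP cop.
  by rewrite -gcdp_eqp1; apply: cop.
(* N strictly exceeds the whole spread of [e]; N = 0 covers the empty spread. *)
have prodm (N : nat) : (forall k : nat, ~~ coprimep e (sg k e) -> (k < N)%N) ->
    e %| \prod_(0 <= j < N) sg (- (l%:Z + j%:Z)) m' /\ e %| \prod_(0 <= j < N) sg j p'.
  move=> hN.
  have cop (k : nat) : (N <= k)%N -> coprimep e (sg k e).
    by move=> Nk; apply/negPn/negP => /hN; rewrite ltnNge Nk.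
  split.
    under eq_bigr => j _ do rewrite opprD addrC sigPzD -mulN1r.
    apply: (shift_divides_prod _ _ _ _ _ _ d0 tmw' dm) => i Ni; rewrite mulN1r.
    by rewrite coprimep_sym coprimep_sigPzN; apply: cop.
  under eq_bigr => j _ do rewrite -[j%:Z]mul1r.
  by apply: (shift_divides_prod _ _ _ _ _ _ d0 tpw dp) => i Ni; rewrite mul1r cop.
have [[-> none]|[M [-> nM maxM]]] := disp_fin e e e0 e0 te.
  (* Without any substitution, [e] divides the empty product 1, hence everything, whatever D is. *)
  split; first by []; have [em ep] := prodm 0%N (fun k h => False_ind _ (negP h (none k))).
  have e1 q : e %| q by apply: dvdp_trans em _; rewrite big_geq // dvd1p.
  exact: e1.
have nD := key M nM maxM.
have [[_ none]|[N [DE _ maxN]]] := disp_fin _ _ m'0 p'0 tp; first by rewrite none in nD.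
have MN := maxN _ nD; rewrite /D DE; split=> //.
(* Since D >= M, the substitution may be made D + 1 times, which yields exactly the factors j =
   0..D. *)
have [|em ep] := prodm N.+1; last by rewrite dvdp_gcd /= em.
by move=> k /maxM kM; rewrite ltnS (leq_trans kM).
Qed.

(** * The powers of sigma on F(t) as ring morphisms *)

HB.instance Definition _ := GRing.RMorphism.copy (@toK F) (@FracField.tofrac {poly F}).

Local Notation sk := (sigKz sF sFi mk).
Local Notation KF := {fraction {poly F}}.

Lemma fracP (x : K F) : exists p q : {poly F}, q != 0 /\ x = toK p / toK q.
Proof.
exists \n_(repr x : {ratio {poly F}}), \d_(repr x : {ratio {poly F}}).
by split; [exact: denom_ratioP | exact: toK_frac].
Qed.

Lemma sigKz_frac (k : int) (p q : {poly F}) : q != 0 ->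
  sk k (toK p / toK q) = toK (sg k p) / toK (sg k q).
Proof.
move=> q0; case: k => n.
  elim: n => [//|n IH]; rewrite [LHS](congr1 (sigK sF mk) IH) sigK_frac ?sigPz_eq0 //.
have step j : sg (Negz j.+1) =1 sg (-1) \o sg (Negz j).
  by move=> r /=; rewrite -sigPzD; congr (sg _ r); lia.
elim: n => [|n IH]; first exact: sigKinv_frac.
by rewrite [LHS](congr1 (sigKinv sFi mk) IH) sigKinv_frac ?sigPz_eq0 // !step.
Qed.

Lemma sigKz_toK (k : int) (p : {poly F}) : sk k (toK p) = toK (sg k p).
Proof.
by rewrite -[toK p]divr1 -(rmorph1 (@toK F)) sigKz_frac ?oner_eq0 // !rmorph1 divr1.
Qed.

Lemma toK_fracB (p q p' q' : {poly F}) : q != 0 -> q' != 0 ->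
  toK p / toK q - toK p' / toK q' = toK (p * q' - p' * q) / toK (q * q') :> KF.
Proof.
move=> q0 q'0; rewrite -mulNr addf_div ?toK_eq0 // mulNr.
by rewrite rmorphB !rmorphM.
Qed.

Lemma sigKz_zmod_morphism (k : int) : zmod_morphism (sk k : KF -> KF).
Proof.
move=> x y; have [p [q [q0 ->]]] := fracP x; have [p' [q' [q'0 ->]]] := fracP y.
rewrite toK_fracB // !sigKz_frac ?mulf_neq0 // toK_fracB ?sigPz_eq0 //.
by rewrite rmorphB !rmorphM.
Qed.

Lemma sigKz_monoid_morphism (k : int) : monoid_morphism (sk k : KF -> KF).
Proof.
split=> [|x y]; first by rewrite -(rmorph1 (@toK F)) sigKz_toK !rmorph1.
have [p [q [q0 ->]]] := fracP x; have [p' [q' [q'0 ->]]] := fracP y.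
by rewrite mulf_div -!rmorphM !sigKz_frac ?mulf_neq0 // mulf_div -!rmorphM.
Qed.

HB.instance Definition _ (k : int) :=
  GRing.isZmodMorphism.Build KF KF (sk k) (sigKz_zmod_morphism k).
HB.instance Definition _ (k : int) :=
  GRing.isMonoidMorphism.Build KF KF (sk k) (sigKz_monoid_morphism k).

Lemma sigKzD (i j : int) (x : K F) : sk (i + j) x = sk i (sk j x).
Proof.
have [p [q [q0 ->]]] := fracP x.
by rewrite !sigKz_frac ?sigPz_eq0 // !sigPzD.
Qed.

(** * The action of Ore Laurent operators on vectors *)

Section Operators.
Context {n : nat}.
Implicit Types (L M : olmx F n) (y : 'cV[KF]_n).

(** Representations of one operator may start and end at different exponents. Summing over any
    window containing the stored exponents makes the action depend on [olc] alone. *)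
Lemma olapply_olc (c : int) (N : nat) L y : c <= ol_lo L ->
  ol_lo L + (size (ol_cs L))%:Z <= c + N%:Z ->
  olapply sF sFi mk L y =
  \sum_(0 <= i < N) olc L (c + i%:Z) *m map_mx (sk (c + i%:Z)) y.
Proof.
case: L => lo cs /= clo hN; rewrite /olapply /olc /=.
have [t tE] : exists t : nat, lo = c + t%:Z by exists `|lo - c|%N; lia.
have tN : (t + size cs <= N)%N by lia.
rewrite [RHS](@big_cat_nat _ _ _ (t + size cs)) //=.
rewrite [X in _ = X + _](@big_cat_nat _ _ _ t) ?leq_addr //=.
rewrite [X in _ = X + _ + _]big_nat_cond [X in _ = X + _ + _]big1 ?add0r; last first.
  by move=> i; rewrite andbT => it; case: ifP => [|_]; [lia | rewrite mul0mx].
rewrite [X in _ = _ + X]big_nat_cond [X in _ = _ + X]big1 ?addr0; last first.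
  have far s i : (t + s <= i)%N -> (s <= `|(c + i%:Z - lo)%R|)%N by lia.
  move=> i; rewrite andbT => /andP[it _].
  by rewrite nth_default ?if_same ?mul0mx //; apply: far.
rewrite -{1}[t]add0n big_addn addKn big_mkord; apply: eq_bigr => i _.
rewrite tE ifT; last by lia.
by congr (nth 0 cs _ *m map_mx (sk _) y); lia.
Qed.

Lemma olapply_ol_eq L M y : ol_eq L M ->
  olapply sF sFi mk L y = olapply sF sFi mk M y.
Proof.
move=> LM; pose a := (`|ol_lo L| + `|ol_lo M|)%N.
pose N := (a + a + size (ol_cs L) + size (ol_cs M))%N.
rewrite !(@olapply_olc (- a%:Z) N); try by rewrite /N /a; lia.
by apply: eq_bigr => i _; rewrite LM.
Qed.

Lemma olapply_olmul L M y :
  olapply sF sFi mk (olmul sF sFi mk L M) y =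
  olapply sF sFi mk L (olapply sF sFi mk M y).
Proof.
case: L M => lo cs [lo' cs']; rewrite /olapply /olmul /=.
rewrite size_map size_iota.
under eq_bigr => m _ do rewrite (nth_map 0%N) ?size_iota // nth_iota // add0n mulmx_suml.
rewrite exchange_big /=; apply: eq_bigr => i _.
under eq_bigr => m _ do rewrite mulmx_suml big_mkcond.
rewrite exchange_big /= (raddf_sum (map_mx (sk (lo + i%:Z)))) mulmx_sumr; apply: eq_bigr => j _.
(* Each pair (i, j) contributes to the single coefficient m = i + j. *)
have ijP : (i + j < size cs + size cs')%N by rewrite -addSn leq_add // ltnW.
rewrite -big_mkcond /= (big_pred1 (Ordinal ijP)) => [|m]; last first.
  by rewrite /= -val_eqE /= eq_sym.
rewrite map_mxM -mulmxA -map_mx_comp; congr (_ *m (_ *m _)).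
apply/matrixP=> a b; rewrite !mxE /= -sigKzD; congr (sk _ _).
by rewrite PoszD; lia.
Qed.

Lemma olapply_of_polys (l : nat) (A : nat -> 'M[{poly F}]_n) y :
  olapply sF sFi mk (ol_of_polys l A) y =
  \sum_(i < l.+1) map_mx (@toK F) (A i) *m map_mx (sk i%:Z) y.
Proof.
rewrite /olapply /ol_of_polys; cbn [ol_cs ol_lo].
rewrite size_map size_iota; apply: eq_bigr => i _.
by rewrite (nth_map 0%N) ?size_iota // nth_iota // add0n add0r.
Qed.

(** * Polynomial vectors and denominators *)

Definition polyvec (v : 'cV[KF]_n) : Prop := exists w, v = map_mx (@toK F) w.

Lemma polyvecD (v w : 'cV[KF]_n) : polyvec v -> polyvec w -> polyvec (v + w).
Proof. by case=> v' -> [w' ->]; exists (v' + w'); rewrite map_mxD. Qed.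

Lemma polyvec_sum (I : Type) (r : seq I) (P : pred I) (f : I -> 'cV[KF]_n) :
  (forall i, P i -> polyvec (f i)) -> polyvec (\sum_(i <- r | P i) f i).
Proof.
move=> hf; apply: big_ind => //; last exact: polyvecD.
by exists 0; rewrite map_mx0.
Qed.

Lemma polyvec_mulmx (N : 'M[{poly F}]_n) (v : 'cV[KF]_n) :
  polyvec v -> polyvec (map_mx (@toK F) N *m v).
Proof. by case=> w ->; exists (N *m w); rewrite map_mxM. Qed.

Lemma polyvec_scale (q : {poly F}) (v : 'cV[KF]_n) :
  polyvec v -> polyvec (toK q *: v).
Proof. by case=> w ->; exists (q *: w); rewrite map_mxZ. Qed.

Lemma sigKz_rep_vec (k : int) (d : {poly F}) (z : 'cV[{poly F}]_n) :
  map_mx (sk k) (rep_vec d z) = rep_vec (sg k d) (map_mx (sg k) z).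
Proof.
apply/matrixP=> i j; rewrite !mxE rmorphM fmorphV /=.
by rewrite !sigKz_toK.
Qed.

Lemma polyvec_dvd (d E : {poly F}) (z : 'cV[{poly F}]_n) :
  d != 0 -> d %| E -> polyvec (toK E *: rep_vec d z).
Proof.
move=> d0 /dvdpP[c ->]; exists (c *: z).
by rewrite /rep_vec scalerA rmorphM mulfK ?toK_eq0 // map_mxZ.
Qed.

(** With the shift undone, [d] divides sigma^(-k)(E) times every entry of [z], hence times their
    gcd, which is coprime to [d]. *)
Lemma reduced_dvd (k : int) (d E : {poly F}) (z : 'cV[{poly F}]_n) :
  reduced_rep d z -> polyvec (toK E *: rep_vec (sg k d) (map_mx (sg k) z)) ->
  sg k d %| E.
Proof.
move=> [d0 cop] [w wE]; rewrite -(sigPzNK k E) dvdp_sigPz.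
rewrite -(Gauss_dvdpl _ cop); elim/big_ind: _ => [|x y dx dy|i _].
- by rewrite mulr0 dvdp0.
- by rewrite (eqp_dvdr _ (mulp_gcdr _ _ _)) dvdp_gcd dx.
rewrite -(dvdp_sigPz k) rmorphM /= sigPzNK; apply/dvdpP; exists (w i 0).
apply: toK_inj; have := congr1 (fun v : 'cV[KF]_n => v i 0) wE.
rewrite !mxE !rmorphM /= => <-; rewrite mulrA mulrAC divfK //.
by rewrite toK_eq0 sigPz_eq0.
Qed.

(** The isolated shift of y equals Q^-1 (v - S). Since [q] clears Q^-1 and [E] clears v - S, their
    product clears that shift. *)
Lemma denom_dvd (k : int) (Q : 'M[KF]_n) (q d E : {poly F}) (z : 'cV[{poly F}]_n)
    (S v : 'cV[KF]_n) :
  Q \in unitmx -> clears_denoms (invmx Q) q -> reduced_rep d z ->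
  Q *m map_mx (sk k) (rep_vec d z) + S = v -> polyvec v -> polyvec (toK E *: S) ->
  sg k d %| q * E.
Proof.
move=> Qu [N NE] dz yE pv pS; apply: (reduced_dvd _ _ _ _ dz); rewrite -sigKz_rep_vec.
have -> : map_mx (sk k) (rep_vec d z) = invmx Q *m (v - S).
  by rewrite -yE addrK mulKmx.
rewrite rmorphM mulrC -scalerA scalemxAl NE scalemxAr.
apply: polyvec_mulmx; rewrite scalerBr; apply: polyvecD; first exact: polyvec_scale.
by rewrite -scaleN1r -(rmorphN1 (@toK F)); apply: polyvec_scale.
Qed.

(** * The two divisibilities satisfied by a solution *)

Section Solution.
Context {l : nat} {A : nat -> 'M[{poly F}]_n} {b : 'cV[{poly F}]_n}.
Context {d : {poly F}} {z : 'cV[{poly F}]_n}.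
Hypotheses (dz : reduced_rep d z)
  (sol : olapply sF sFi mk (ol_of_polys l A) (rep_vec d z) = map_mx (@toK F) b).

Lemma polyvec_term (k : int) (E : {poly F}) (B : 'M[{poly F}]_n) : sg k d %| E ->
  polyvec (toK E *: (map_mx (@toK F) B *m map_mx (sk k) (rep_vec d z))).
Proof.
move=> dE; rewrite scalemxAr sigKz_rep_vec; apply: polyvec_mulmx.
by apply: polyvec_dvd => //; rewrite sigPz_eq0; case: dz.
Qed.

(** Isolates the term with sigma^l, then shifts the resulting divisibility back by l. *)
Lemma head_shift_divides (m : {poly F}) : \det (map_mx (@toK F) (A l)) != 0 ->
  clears_denoms (invmx (map_mx (@toK F) (A l))) m ->
  shift_divides (-1) l (sg (- l%:Z) m) d.
Proof.
move=> Al mA E hE; have yE := sol.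
rewrite olapply_of_polys big_ord_recr /= addrC in yE.
rewrite -(dvdp_sigPz l) rmorphM /= sigPzNK.
have Au : map_mx (@toK F) (A l) \in unitmx by rewrite unitmxE unitfE.
apply: (denom_dvd _ _ _ _ _ _ _ _ Au mA dz yE); first by exists b.
rewrite scaler_sumr; apply: polyvec_sum => i _; apply: polyvec_term.
rewrite -(dvdp_sigPz (- l%:Z)) sigPzK -sigPzD.
(* The remaining terms have i < l, so 1 <= l - i <= l as [shift_divides] requires. *)
rewrite (_ : _ + _ = -1 * (l - i)%N%:Z); last by have := ltn_ord i; lia.
by apply: hE; have := ltn_ord i; lia.
Qed.

(** Isolates the term with sigma^0; meant for the transformed system (PA)(y) = P(b). *)
Lemma tail_shift_divides (p : {poly F}) : \det (A 0%N) != 0 ->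
  clears_denoms (invmx (map_mx (@toK F) (A 0%N))) p -> shift_divides 1 l p d.
Proof.
move=> A0 pA E hE; have yE := sol.
rewrite olapply_of_polys big_ord_recl /= in yE.
have Au : map_mx (@toK F) (A 0%N) \in unitmx.
  by rewrite unitmxE unitfE det_map_mx /= toK_eq0.
apply: (denom_dvd 0 _ _ _ _ _ _ _ Au pA dz yE); first by exists b.
rewrite scaler_sumr; apply: polyvec_sum => i _; apply: polyvec_term.
by have := hE i.+1; rewrite mul1r; apply; have := ltn_ord i; lia.
Qed.

End Solution.
End Operators.
End PiSigmaExtension.

Theorem theorem2
  (F : fieldType) (sF : {rmorphism F -> F}) (sFi : F -> F) (mk : monokind F)
  (n l : nat) (A : nat -> 'M[{poly F}]_n) (b : 'cV[{poly F}]_n)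
  (P : olmx F n) (lt : nat) (At : nat -> 'M[{poly F}]_n)
  (m p d : {poly F}) (z : 'cV[{poly F}]_n) :
  PiSigma_ext sF sFi mk ->
  fully_regular sF sFi mk l A ->
  ol_unimodular sF sFi mk P ->
  ol_eq (olmul sF sFi mk P (ol_of_polys l A)) (ol_of_polys lt At) ->
  (exists Pb : 'cV[{poly F}]_n,
      olapply sF sFi mk P (map_mx (@toK F) b) = map_mx (@toK F) Pb) ->
  \det (At 0%N) != 0 ->
  common_denom (invmx (map_mx (@toK F) (A l))) m ->
  common_denom (invmx (map_mx (@toK F) (At 0%N))) p ->
  reduced_rep d z ->
  olapply sF sFi mk (ol_of_polys l A) (rep_vec d z) = map_mx (@toK F) b ->
  let D := disp sF sFi mk (sigPz sF sFi mk (- (l%:Z)) (ap mk m)) (ap mk p) in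
  extnat_le (disp sF sFi mk (ap mk d) (ap mk d)) D /\
  ap mk d %| gcdp
    (prod_upto D (fun j => sigPz sF sFi mk (- (l%:Z + j%:Z)) (ap mk m)))
    (prod_upto D (fun j => sigPz sF sFi mk j%:Z (ap mk p))).

Proof.
move=> ext [Al _] _ PA [Pb PbE] At0 [m0 mA _] [p0 pA _] dz yb D.
(* The same y solves the transformed system, because products of operators act as compositions. *)
have PAy : olapply sF sFi mk (ol_of_polys lt At) (rep_vec d z) = map_mx (@toK F) Pb.
  by rewrite -(olapply_ol_eq _ _ _ PA) (olapply_olmul ext) yb.
have [d0 _] := dz; apply: (disp_bound ext l lt) => //.
  exact: (head_shift_divides ext dz yb).
exact: (tail_shift_divides ext dz PAy).
Qed.
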